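(* Let $N\ge 0$ be an integer, let $g\in L^1(\mathbb T)$ be nonnegative, and set $s=\int_{\mathbb T}g\,dm$, assumed to satisfy $s>0$. Let $\sigma_Ng$ be the $N$th Fejér mean of $g$. Then, for every $1\le p<\infty$, \[ \|\sigma_Ng\|_p\ge s . \] Moreover, if $\sigma_Ng>0$ a.e., then \[ \frac1s\int_{\mathbb T}\sigma_Ng\,\log\left(\frac{\sigma_Ng}{s}\right)dm\ge 0 . \] For $p>1$, equality in the first inequality holds if and only if $\sigma_Ng=s$ a.e.; likewise, when $\sigma_Ng>0$ a.e., equality in the second (entropy) inequality holds if and only if $\sigma_Ng=s$ a.e.
   Context: $\mathbb T=\mathbb R/2\pi\mathbb Z$ is equipped with normalized Lebesgue measure $dm(\theta)=d\theta/(2\pi)$, and $\|\cdot\|_p$ is the norm of $L^p(\mathbb T,m)$. $F_N$ denotes the Fejér kernel $F_N(\theta)=\sum_{|k|\le N}\left(1-\frac{|k|}{N+1}\right)e^{ik\theta}$, and the $N$th Fejér mean of $g\in L^1(\mathbb T)$ is $\sigma_Ng(\theta)=\int_{\mathbb T}F_N(\theta-\varphi)g(\varphi)\,dm(\varphi)$. *)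

(* Defs.v *)
From HB Require Import structures.
From mathcomp Require Import all_boot all_order all_algebra.
From mathcomp Require Import all_classical all_reals all_analysis.
From mathcomp Require Import complex.

Set Implicit Arguments.
Unset Strict Implicit.
Unset Printing Implicit Defensive.

Import Order.TTheory GRing.Theory Num.Theory.
Import numFieldNormedType.Exports.

Local Open Scope classical_set_scope.
Local Open Scope ring_scope.

Section torus_measure.
Context {R : realType}.

Let twopi_gt0 : 0 < pi *+ 2 :> R.
Proof. by rewrite mulrn_wgt0 ?pi_gt0. Qed.

Let twopi_inv_ge0 : 0 <= (pi *+ 2)^-1 :> R.
Proof. by rewrite invr_ge0 ltW. Qed.

(* Functions on R/2piZ are represented by 2pi-periodic functions on R, and
   dtheta/(2pi) by Lebesgue measure on the fundamental domain [0, 2pi[ divided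
   by 2pi. *)
Definition torus_measure : set (measurableTypeR R) -> \bar R :=
  mscale (NngNum twopi_inv_ge0)
    (mrestr lebesgue_measure (measurable_itv `[0, pi *+ 2[)).

HB.instance Definition _ := Measure.on torus_measure.

Let torus_measure_setT : torus_measure setT = 1%E.
Proof.
rewrite /torus_measure /mscale /= /mrestr setTI lebesgue_measure_itv /=.
by rewrite lte_fin twopi_gt0 sube0 -EFinM mulVf// gt_eqF.
Qed.

HB.instance Definition _ :=
  Measure_isProbability.Build _ _ _ torus_measure torus_measure_setT.

End torus_measure.

Section fejer.
Context {R : realType}.
Local Open Scope complex_scope.
Implicit Types (N : nat) (g : R -> R) (x : R).

Definition expi x : R[i] := cos x +i* sin x.

(* The index j < 2N+1 stands for the frequency k = j - N, so that |k| <= N. *)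
Definition fejer_kernelC N x : R[i] :=
  \sum_(j < N.*2.+1) let k : int := j%:Z - N%:Z in
    (1 - `|k|%:~R / N.+1%:R)%:C * expi (k%:~R * x).

(* The kernel is real-valued (fejer_kernelE), so taking the real part only
   changes its codomain. *)
Definition fejer_kernel N x : R := complex.Re (fejer_kernelC N x).

Lemma fejer_kernelE N x : fejer_kernelC N x = (fejer_kernel N x)%:C.
Proof.
suff H : complex.Im (fejer_kernelC N x) = 0.
  by move: H; rewrite /fejer_kernel; case: (fejer_kernelC N x) => a b /= ->.
have -> : complex.Im (fejer_kernelC N x) = \sum_(j < N.*2.+1)
    (1 - `|j%:Z - N%:Z|%:~R / N.+1%:R) * sin ((j%:Z - N%:Z)%:~R * x).
  rewrite /fejer_kernelC (raddf_sum (@complex.Im R : {additive _ -> _})).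
  by apply: eq_bigr => j _ /=; rewrite mul0r addr0.
set S := \sum_(j < _) _.
suff SN : S = - S by apply/eqP; rewrite -eqNr -SN.
rewrite {1}/S (reindex_inj rev_ord_inj) /S -sumrN; apply: eq_bigr => j _ /=.
have -> : (N.*2.+1 - j.+1)%N%:Z - N%:Z = - (j%:Z - N%:Z).
  rewrite subSS -subzn; last by rewrite -ltnS.
  have -> : N.*2%:Z = N%:Z + N%:Z by rewrite -addnn PoszD.
  by rewrite opprB addrAC addrK.
by rewrite normrN mulrNz mulNr sinN mulrN.
Qed.

Definition fejer_mean N g x : R :=
  \int[torus_measure]_y (fejer_kernel N (x - y) * g y).

End fejer.

(* Main.v *)
(** The kernel is a trigonometric polynomial, hence so is the Fejér mean
    [sigma]: it is bounded and measurable, and only its zero frequency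
    contributes to its integral, which is therefore [s].
    For a convex [phi] with supporting line [phi s + c (t - s)] at [s],
    integrating [phi (sigma x) >= phi s + c (sigma x - s)] gives
    [\int phi (sigma x) >= phi s]; if the line touches the graph of [phi] only
    at [s], equality forces [sigma = s] almost everywhere. Both claims are
    instances, with [phi t = |t|^p] and [phi t = t ln (t / s)]. *)

Require Import Defs.
From mathcomp Require Import all_boot all_order all_algebra.
From mathcomp Require Import all_classical all_reals all_analysis.
From mathcomp Require Import measurable_realfun complex lra ring.

Set Implicit Arguments.
Unset Strict Implicit.
Unset Printing Implicit Defensive.

Import Order.TTheory GRing.Theory Num.Theory.
Import numFieldNormedType.Exports.

Local Open Scope classical_set_scope.
Local Open Scope ring_scope.

(** * Integration of bounded functions and of supporting lines on a probability space *)

Section probability_space.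
Context d (T : measurableType d) (R : realType) (P : probability T R).

Lemma probability_bounded_integrable (f : T -> R) (M : R) :
  measurable_fun setT f -> (forall x, `|f x| <= M) ->
  P.-integrable setT (EFin \o f).
Proof.
move=> mf fM; apply: measurable_bounded_integrable => //.
  by rewrite ltey_eq fin_num_measure.
by exists M; split; [exact: num_real|move=> y My x _; apply: le_trans (ltW My)].
Qed.

Lemma probability_integrable_cst (r : R) :
  P.-integrable setT (EFin \o cst r).
Proof.
by apply: (probability_bounded_integrable (M := `|r|)).
Qed.

Lemma Rintegral_probability_cst (r : R) : \int[P]_x r = r.
Proof.
by rewrite Rintegral_cst// (congr1 fine (probability_setT P)) mulr1.
Qed.

Lemma Rintegral_sum (I : Type) (r : seq I) (f : I -> T -> R) :
  (forall i, P.-integrable setT (EFin \o f i)) ->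
  \int[P]_x (\sum_(i <- r) f i x) = \sum_(i <- r) \int[P]_x f i x.
Proof.
move=> fi; rewrite /Rintegral; under eq_integral do rewrite -sumEFin.
rewrite integral_sum// sum_fine// => i _.
have := fi i; exact: integrable_fin_num.
Qed.

(** The affine function of [X] on the left has integral [y], because [P] has mass 1 and [X] has mean
    [s]. If [Y] has integral [y] too, the nonnegative difference has integral 0, so it vanishes
    almost everywhere, and the contact condition then gives [X x = s]. *)
Lemma tangent_integral_ge (X Y : T -> R) (s y c : R) :
  P.-integrable setT (EFin \o X) -> P.-integrable setT (EFin \o Y) ->
  \int[P]_x X x = s -> (forall x, y + c * (X x - s) <= Y x) ->
  (y%:E <= \int[P]_x (Y x)%:E)%E /\
  ((forall x, Y x = y + c * (X x - s) -> X x = s) ->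
   (\int[P]_x (Y x)%:E)%E = y%:E -> {ae P, forall x, X x = s}).
Proof.
move=> iX iY Xs XY.
pose L x := y + c * (X x - s).
have icst := probability_integrable_cst.
have iXs : P.-integrable setT (EFin \o (fun x => X x - s)).
  exact: (integrableB measurableT iX (icst s)).
have icX : P.-integrable setT (EFin \o (fun x => c * (X x - s))).
  exact: (integrableZl measurableT c iXs).
have iL : P.-integrable setT (EFin \o L) by exact: (integrableD measurableT (icst y) icX).
have intcst := Rintegral_probability_cst.
have intL : \int[P]_x L x = y.
  rewrite RintegralD// ?intcst; last exact: icst.
  rewrite RintegralZl// RintegralB// ?Xs ?intcst ?subrr ?mulr0 ?addr0//.
  exact: icst.
have intY : (\int[P]_x (Y x)%:E)%E = (\int[P]_x Y x)%:E.
  by rewrite /Rintegral fineK//; exact: integrable_fin_num.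
have iYL : P.-integrable setT (EFin \o (fun x => Y x - L x)).
  exact: (integrableB measurableT iY iL).
have intYL : \int[P]_x (Y x - L x) = \int[P]_x Y x - y.
  by rewrite RintegralB// intL.
split.
  rewrite intY lee_fin -subr_ge0 -intYL; apply: Rintegral_ge0 => x _.
  by rewrite subr_ge0 XY.
move=> Yeq; rewrite intY => -[Yy].
have : (\int[P]_x `|(Y x - L x)%:E|)%E = 0.
  under eq_integral do rewrite gee0_abs ?lee_fin ?subr_ge0 ?XY//.
  rewrite -[LHS]fineK; last exact: (integrable_fin_num _ iYL).
  by rewrite [X in X%:E]intYL Yy subrr.
move/ae_eq_integral_abs => /(_ measurableT (measurable_int _ iYL)).
apply: filterS => x /= /(_ I) [/eqP]; rewrite subr_eq0 => /eqP; exact: Yeq.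
Qed.

(** This serves the converse half of both equality cases. *)
Lemma ae_cst_integral (X : T -> R) (phi : R -> R) (s : R) :
  measurable_fun setT X -> measurable_fun setT phi ->
  {ae P, forall x, X x = s} -> (\int[P]_x (phi (X x))%:E)%E = (phi s)%:E.
Proof.
move=> mX mphi aes.
have aephi : ae_eq P setT (EFin \o (phi \o X)) (EFin \o cst (phi s)).
  by apply: filterS aes => x sx _; rewrite /= sx.
have mphiX : measurable_fun setT (EFin \o (phi \o X)).
  by apply/measurable_EFinP; exact: measurableT_comp.
rewrite (ae_eq_integral (cst (phi s)%:E) _ measurableT mphiX (measurable_cst _) aephi).
rewrite -[LHS]fineK; last first.
  exact: integrable_fin_num (probability_integrable_cst _).
by congr EFin; exact: Rintegral_probability_cst.
Qed.

End probability_space.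

(** * Tangent lines at [s] of the power function and of [t * ln (t / s)] *)

Section tangent_lines.
Variable R : realType.
Implicit Types p s t u : R.

(* Convexity of exp at u, a barycentre of p u and 0 with weights 1/p and 1 - 1/p. *)
Lemma bernoulli_expR p u : 1 <= p ->
  p * expR u <= expR (p * u) + (p - 1).
Proof.
move=> p1.
have e1 := expR_ge1Dx ((p - 1) * u).
have e2 := expR_ge1Dx (- u).
have -> : expR (p * u) = expR u * expR ((p - 1) * u).
  by rewrite -expRD; congr expR; ring.
have e3 : expR u * expR (- u) = 1 by rewrite -expRD subrr expR0.
have eu := expR_gt0 u.
have h1 : expR u * (1 + (p - 1) * u) <= expR u * expR ((p - 1) * u).
  by rewrite ler_pM2l.
have h2 : expR u * (1 - u) * (p - 1) <= 1 * (p - 1).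
  by apply: ler_wpM2r; [rewrite subr_ge0|rewrite -[leRHS]e3 ler_pM2l].
(* In the sum of [h1] and [h2] the terms in [u * expR u] cancel, which leaves the claim. *)
nra.
Qed.

(** Strictness comes from [1 - u < expR (- u)] alone; the factor [p - 1 > 0] preserves it. *)
Lemma bernoulli_expR_lt p u : 1 < p -> u != 0 ->
  p * expR u < expR (p * u) + (p - 1).
Proof.
move=> p1 u0.
have e1 := expR_ge1Dx ((p - 1) * u).
have /expR_gt1Dx e2 : - u != 0 by rewrite oppr_eq0.
have -> : expR (p * u) = expR u * expR ((p - 1) * u).
  by rewrite -expRD; congr expR; ring.
have e3 : expR u * expR (- u) = 1 by rewrite -expRD subrr expR0.
have eu := expR_gt0 u.
have h1 : expR u * (1 + (p - 1) * u) <= expR u * expR ((p - 1) * u).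
  by rewrite ler_pM2l.
have h2 : expR u * (1 - u) * (p - 1) < 1 * (p - 1).
  by rewrite ltr_pM2r ?subr_gt0// -[ltRHS]e3 ltr_pM2l.
nra.
Qed.

(** Division by s^p turns this into Bernoulli's inequality for [t / s], which for positive [t] is
    [bernoulli_expR] at [u = ln (t / s)]. The slope is p s^(p-1), written with a quotient so that
    only the exponent [p] occurs. *)
Lemma powR_tangent p s t : 1 <= p -> 0 < s ->
  s `^ p + p * s `^ p / s * (t - s) <= `|t| `^ p.
Proof.
move=> p1 s0; have sp : 0 < s `^ p by exact: powR_gt0.
have -> : s `^ p + p * s `^ p / s * (t - s) = s `^ p * (1 + p * (t / s - 1)).
  by field; rewrite gt_eqF.
(* For nonpositive [t] the tangent is at most s^p (1 - p), hence at most 0. *)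
have [t0|t0] := leP t 0.
  apply: le_trans (powR_ge0 _ _); rewrite pmulr_rle0//.
  have : t / s <= 0 by rewrite pmulr_lle0 ?invr_gt0.
  nra.
rewrite gtr0_norm//; have ts : 0 < t / s by rewrite divr_gt0.
have {2}-> : t = s * (t / s) by rewrite mulrCA divff ?mulr1// gt_eqF.
rewrite powRM ?(ltW s0) ?(ltW ts)// ler_pM2l//.
rewrite [leRHS]/powR gt_eqF//; have := bernoulli_expR (ln (t / s)) p1.
rewrite lnK//; lra.
Qed.

(** With [1 < p] the tangent is negative for [t <= 0], so contact can only occur at a positive [t];
    there the strict Bernoulli inequality forces [ln (t / s) = 0]. *)
Lemma powR_tangent_eq p s t : 1 < p -> 0 < s ->
  `|t| `^ p = s `^ p + p * s `^ p / s * (t - s) -> t = s.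
Proof.
move=> p1 s0; have sp : 0 < s `^ p by exact: powR_gt0.
have -> : s `^ p + p * s `^ p / s * (t - s) = s `^ p * (1 + p * (t / s - 1)).
  by field; rewrite gt_eqF.
have [t0|t0] := leP t 0.
  have tsp := powR_ge0 `|t| p.
  have ts : t / s <= 0 by rewrite pmulr_lle0 ?invr_gt0.
  have : s `^ p * (1 + p * (t / s - 1)) < 0 by rewrite pmulr_rlt0//; nra.
  lra.
rewrite gtr0_norm//; have ts : 0 < t / s by rewrite divr_gt0.
have {1}-> : t = s * (t / s) by rewrite mulrCA divff ?mulr1// gt_eqF.
rewrite powRM ?(ltW s0) ?(ltW ts)// => /(mulfI (lt0r_neq0 sp)).
rewrite [LHS]/powR gt_eqF//.
have [/eqP|u0] := eqVneq (ln (t / s)) 0.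
  by rewrite ln_eq0// => /eqP /divr1_eq.
have := bernoulli_expR_lt p1 u0; rewrite lnK//; lra.
Qed.

(* [ln] is [0] on nonpositive reals, so no sign condition on [t] is needed. *)
Lemma xlnx_tangent s t : 0 < s -> t - s <= t * ln (t / s).
Proof.
move=> s0; have [t0|t0] := leP t 0.
  rewrite ln0 ?mulr0; first lra.
  by rewrite pmulr_lle0 ?invr_gt0.
have := expR_ge1Dx (- ln (t / s)).
rewrite expRN lnK ?posrE ?divr_gt0// invf_div => h.
have : t * (1 - ln (t / s)) <= t * (s / t) by rewrite ler_pM2l.
rewrite mulrCA divff ?gt_eqF//; lra.
Qed.

(** For positive [t], a nonzero [u = ln (t / s)] gives [1 - u < expR (- u) = s / t], and multiplying
    by [t] contradicts the equality. *)
Lemma xlnx_tangent_eq s t : 0 < s -> t * ln (t / s) = t - s -> t = s.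
Proof.
move=> s0; have [t0|t0] := leP t 0.
  rewrite ln0 ?mulr0; first lra.
  by rewrite pmulr_lle0 ?invr_gt0.
have [/eqP|u0] := eqVneq (ln (t / s)) 0.
  by rewrite ln_eq0 ?divr_gt0// => /eqP /divr1_eq.
have /expR_gt1Dx : - ln (t / s) != 0 by rewrite oppr_eq0.
rewrite expRN lnK ?posrE ?divr_gt0// invf_div => h.
have : t * (1 - ln (t / s)) < t * (s / t) by rewrite ltr_pM2l.
rewrite mulrCA divff ?gt_eqF//; lra.
Qed.

(** This makes the entropy integrand bounded. The tangent line bounds it below by [- M - s]; for
    positive [t], [ln x < x] bounds it above by [t ^+ 2 / s]. *)
Lemma xlnx_bound s t M : 0 < s -> `|t| <= M ->
  `|t * ln (t / s)| <= M + s + M ^+ 2 / s.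
Proof.
move=> s0 tM; have M0 : 0 <= M by apply: le_trans tM.
have Ms : 0 <= M ^+ 2 / s by rewrite divr_ge0 ?sqr_ge0// ltW.
move: (tM); rewrite ler_norml => /andP[t1 t2].
rewrite ler_norml; apply/andP; split.
  by have := xlnx_tangent t s0; lra.
have [t0|t0] := leP t 0.
  rewrite ln0 ?mulr0; first lra.
  by rewrite pmulr_lle0 ?invr_gt0.
have /ltW h := ln_sublinear (divr_gt0 t0 s0).
apply: (@le_trans _ _ (t * (t / s))); first by rewrite ler_pM2l.
rewrite mulrA -expr2; apply: (@le_trans _ _ (M ^+ 2 / s)); last lra.
by rewrite ler_pM2r ?invr_gt0// ler_sqr ?nnegrE// ltW.
Qed.

End tangent_lines.

(** * Integrals of trigonometric functions over the torus *)

Section torus.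
Variable R : realType.

Let D : set R := `[0, pi *+ 2[%classic.
Let twopi_gt0 : 0 < pi *+ 2 :> R.
Proof. by rewrite mulrn_wgt0 ?pi_gt0. Qed.

(** This passes to a closed interval, where the fundamental theorem of calculus applies: the
    complement of [D] is null for [torus_measure], and adding the right endpoint does not change the
    Lebesgue integral. *)
Lemma ge0_torus_integral (f : R -> R) :
  continuous f -> (forall x, 0 <= f x) ->
  (\int[torus_measure]_x (f x)%:E =
   (pi *+ 2)^-1%:E * \int[lebesgue_measure]_(x in `[0%R, (pi *+ 2)%R]) (f x)%:E)%E.
Proof.
move=> cf f0.
have mf : measurable_fun [set: R] (EFin \o f).
  by apply/measurable_EFinP; exact: continuous_measurable_fun.
have mD : measurable (D : set (measurableTypeR R)) by exact: measurable_itv.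
have k0 : 0 <= (pi *+ 2)^-1 :> R by rewrite invr_ge0 ltW.
have mCD : measurable (~` D : set (measurableTypeR R)) by exact: measurableC.
have f0' x : [set: R] x -> (0 <= (EFin \o f) x)%E by rewrite lee_fin.
have D0 : torus_measure (~` D : set (measurableTypeR R)) = 0%E.
  rewrite /torus_measure /mscale/= /mrestr.
  by rewrite (_ : _ `&` _ = set0) ?measure0 ?mule0// setICl.
rewrite (@ge0_negligible_integral _ (measurableTypeR R) R torus_measure setT
  (~` D) (EFin \o f) mCD measurableT mf f0' D0).
rewrite setDE setCK setTI.
rewrite (@eq_measure_integral _ _ _ _ (mscale (NngNum k0) lebesgue_measure)); last first.
  move=> A mA AD; rewrite /torus_measure /mscale/= /mrestr.
  by congr (_ * lebesgue_measure _)%E; exact: (setIidl AD).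
rewrite ge0_integral_mscale//=; last first.
- by move=> x _; rewrite lee_fin.
- exact: measurable_funTS.
by rewrite integral_itv_bndo_bndc//; exact: measurable_funTS.
Qed.

Lemma sinD2piz (x : R) (k : int) : sin (x + (pi *+ 2) *~ k) = sin x.
Proof.
have P := periodicn (@sinD2pi R).
case: k => n; first exact: P.
by rewrite NegzE mulrNz -(P n.+1) subrK.
Qed.

(** The phase [c] lets one computation cover sines as well, through a shift by a quarter period. *)
Lemma torus_integral_cos (k : int) (c : R) : k != 0 ->
  \int[torus_measure]_x cos (k%:~R * x + c) = 0.
Proof.
move=> k0; have w0 : k%:~R != 0 :> R by rewrite intr_eq0.
set w : R := k%:~R in w0 *.
have clin : continuous (fun x : R => w * x + c).
  move=> x; apply: cvgD; last exact: cvg_cst.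
  by apply: cvgM; [exact: cvg_cst|exact: cvg_id].
have ccos : continuous (fun x : R => cos (w * x + c)).
  move=> x; apply: (@continuous_comp _ _ _ (fun x => w * x + c) cos).
    exact: clin.
  exact: continuous_cos.
(* Adding 1 makes the integrand nonnegative, as [ge0_torus_integral] requires. *)
pose f x : R := 1 + cos (w * x + c).
pose F x : R := x + w^-1 * sin (w * x + c).
have cf : continuous f by move=> x; apply: cvgD; [exact: cvg_cst|exact: ccos].
have dF (x : R) : is_derive x 1 F (f x).
  rewrite /F /f.
  have d1 : is_derive x 1 (fun x : R => w * x + c) w.
    by apply: is_derive_eq; rewrite addr0 scaler1.
  have d2 := @is_derive1_comp _ sin (fun x : R => w * x + c) _ _ _ (is_derive_sin _) d1.
  have := is_deriveD (is_derive_id x 1) (is_deriveZ w^-1 d2).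
  by rewrite scalerAr /= /GRing.scale/= mulVf// mulr1.
have intf : (\int[torus_measure]_x (f x)%:E = 1)%E.
  rewrite ge0_torus_integral//; last first.
    by move=> x; rewrite /f addrC -lerBlDr sub0r cos_geN1.
  rewrite (@continuous_FTC2 _ f F)//; last 3 first.
  - exact: continuous_subspaceT.
  - have cF : continuous F.
      by move=> x; apply/differentiable_continuous/derivable1_diffP; case: (dF x).
    split.
    + by move=> x _; case: (dF x).
    + exact/cvg_at_right_filter/cF.
    + exact/cvg_at_left_filter/cF.
  - by move=> x _; rewrite derive1E; case: (dF x).
  (* Since [k] is an integer, the sine terms of [F] agree at both endpoints, and only the length of
     the interval remains. *)
  rewrite /F mulr0 !add0r [w * _ + c]addrC mulrzl sinD2piz.
  by rewrite -EFinB -EFinM addrK mulVf// gt_eqF.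
have icos : torus_measure.-integrable setT (EFin \o (fun x => cos (w * x + c))).
  apply: (@probability_bounded_integrable _ _ _ _ _ 1).
    exact: continuous_measurable_fun.
  by move=> x; rewrite ler_norml cos_geN1 cos_le1.
have i1 := probability_integrable_cst (@torus_measure R) 1.
have := RintegralD measurableT i1 icos.
rewrite {1}/Rintegral intf (Rintegral_probability_cst (@torus_measure R)).
by move=> /= => /eqP; rewrite -subr_eq0 opprD addrA subrr sub0r oppr_eq0 => /eqP.
Qed.

Lemma torus_integral_cosz (k : int) :
  \int[torus_measure]_x cos (k%:~R * x) = (k == 0)%:R :> R.
Proof.
have [->|k0] := eqVneq k 0.
  under eq_Rintegral do rewrite mul0r cos0.
  exact: (Rintegral_probability_cst (@torus_measure R)).
under eq_Rintegral do rewrite -[_ * _]addr0.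
exact: torus_integral_cos.
Qed.

Lemma torus_integral_sinz (k : int) :
  \int[torus_measure]_x sin (k%:~R * x) = 0 :> R.
Proof.
have [->|k0] := eqVneq k 0.
  under eq_Rintegral do rewrite mul0r sin0.
  exact: (Rintegral_probability_cst (@torus_measure R)).
under eq_Rintegral do rewrite -cosBpihalf.
exact: torus_integral_cos.
Qed.

(** * The Fejér kernel and the Fejér mean as real trigonometric polynomials *)

Definition fejer_freq (N j : nat) : int := j%:Z - N%:Z.

Definition fejer_weight (N j : nat) : R :=
  1 - `|fejer_freq N j|%:~R / N.+1%:R.

Lemma fejer_kernel_cos N (x : R) :
  fejer_kernel N x =
  \sum_(j < N.*2.+1) fejer_weight N j * cos ((fejer_freq N j)%:~R * x).
Proof.
rewrite /fejer_kernel /fejer_kernelC.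
rewrite (raddf_sum (@complex.Re R : {additive _ -> _})).
by apply: eq_bigr => j _ /=; rewrite mul0r subr0.
Qed.

Let normr_cos_le1 (x : R) : `|cos x| <= 1.
Proof. by rewrite ler_norml cos_geN1 cos_le1. Qed.

Let normr_sin_le1 (x : R) : `|sin x| <= 1.
Proof. by rewrite ler_norml sin_geN1 sin_le1. Qed.

Lemma measurable_dilation (h : R -> R) (w : R) : continuous h ->
  measurable_fun [set: R] (fun x => h (w * x)).
Proof.
move=> ch; apply: continuous_measurable_fun => x.
apply: (@continuous_comp _ _ _ (fun x => w * x) h); last exact: ch.
by apply: cvgM; [exact: cvg_cst|exact: cvg_id].
Qed.

Lemma torus_integrable_dilation (h : R -> R) (w : R) :
  continuous h -> (forall x, `|h x| <= 1) ->
  torus_measure.-integrable setT (EFin \o (fun x => h (w * x))).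
Proof.
move=> ch h1; apply: (@probability_bounded_integrable _ _ _ _ _ 1) => //.
exact: measurable_dilation.
Qed.

Section fejer_mean.
Variables (N : nat) (g : R -> R).
Hypothesis g_int : torus_measure.-integrable setT (EFin \o g).

(** Without the customary factor 2 of real Fourier coefficients, since the frequencies [k] and [- k]
    are both summed over. *)
Definition cos_coef (k : int) : R :=
  \int[torus_measure]_y (cos (k%:~R * y) * g y).

Definition sin_coef (k : int) : R :=
  \int[torus_measure]_y (sin (k%:~R * y) * g y).

Lemma torus_integrable_dilationM (h : R -> R) (w : R) :
  continuous h -> (forall x, `|h x| <= 1) ->
  torus_measure.-integrable setT (EFin \o (fun y => h (w * y) * g y)).
Proof.
move=> ch h1.
have bh : [bounded h (w * x) | x in [set: measurableTypeR R]].
  exists 1; split; first exact: num_real.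
  by move=> y y1 x _; apply: le_trans (ltW y1).
exact: (@integrableMr _ (measurableTypeR R) R torus_measure setT measurableT _ _
  (measurable_dilation w ch) bh g_int).
Qed.

Lemma fejer_meanE x :
  fejer_mean N g x = \sum_(j < N.*2.+1) let k := fejer_freq N j in
    fejer_weight N j *
    (cos_coef k * cos (k%:~R * x) + sin_coef k * sin (k%:~R * x)).
Proof.
pose T h (k : int) y : R := h (k%:~R * x) * (h (k%:~R * y) * g y).
have iT h (k : int) : continuous h -> (forall x, `|h x| <= 1) ->
    torus_measure.-integrable setT (EFin \o T h k).
  move=> ch h1.
  exact: (integrableZl measurableT _ (torus_integrable_dilationM k%:~R ch h1)).
have iTD (k : int) :
    torus_measure.-integrable setT (EFin \o (fun y => T cos k y + T sin k y)).
  exact: (integrableD measurableT (iT _ k (@continuous_cos R) normr_cos_le1)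
    (iT _ k (@continuous_sin R) normr_sin_le1)).
pose S j y := fejer_weight N j *
  (T cos (fejer_freq N j) y + T sin (fejer_freq N j) y).
transitivity (\int[torus_measure]_y \sum_(j < N.*2.+1) S j y).
  apply: eq_Rintegral => y _; rewrite fejer_kernel_cos mulr_suml.
  by apply: eq_bigr => j _; rewrite mulrBr cosB /S /T; ring.
rewrite Rintegral_sum; last first.
  by move=> j; exact: (integrableZl measurableT _ (iTD _)).
apply: eq_bigr => j _ /=; rewrite RintegralZl// RintegralD//; last 2 first.
- by apply: iT => //; exact: continuous_cos.
- by apply: iT => //; exact: continuous_sin.
rewrite RintegralZl//; last exact: torus_integrable_dilationM (@continuous_cos R) _.
rewrite RintegralZl//; last exact: torus_integrable_dilationM (@continuous_sin R) _.
by rewrite [cos _ * _]mulrC [sin _ * _]mulrC.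
Qed.

Lemma measurable_fejer_mean : measurable_fun [set: R] (fejer_mean N g).
Proof.
rewrite (funext fejer_meanE) /=; apply: measurable_sum => j.
apply: measurable_funM => //; apply: measurable_funD.
  apply: measurable_funM => //; apply: measurable_dilation.
  exact: continuous_cos.
apply: measurable_funM => //; apply: measurable_dilation.
exact: continuous_sin.
Qed.

Lemma fejer_mean_bounded : exists M, forall x, `|fejer_mean N g x| <= M.
Proof.
exists (\sum_(j < N.*2.+1) let k := fejer_freq N j in
  `|fejer_weight N j| * (`|cos_coef k| + `|sin_coef k|)) => x.
rewrite fejer_meanE (le_trans (ler_norm_sum _ _ _))//.
apply: ler_sum => j _ /=; rewrite normrM ler_wpM2l//.
by rewrite (le_trans (ler_normD _ _))// lerD// normrM ler_piMr.
Qed.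

Lemma fejer_mean_integrable :
  torus_measure.-integrable setT (EFin \o fejer_mean N g).
Proof.
have [M gM] := fejer_mean_bounded.
exact: (@probability_bounded_integrable _ (measurableTypeR R) R torus_measure _ _
  measurable_fejer_mean gM).
Qed.

(** Every nonzero frequency integrates to 0. The zero frequency has weight 1, and its cosine
    coefficient is the integral of [g]. *)
Lemma Rintegral_fejer_mean :
  \int[torus_measure]_x fejer_mean N g x = \int[torus_measure]_x g x.
Proof.
have ic k := torus_integrable_dilation k (@continuous_cos R) normr_cos_le1.
have is_ k := torus_integrable_dilation k (@continuous_sin R) normr_sin_le1.
have iZ h (r : R) := @integrableZl _ _ _ torus_measure _ measurableT r h.
have iD a b k := integrableD measurableT (iZ _ a (ic k)) (iZ _ b (is_ k)).
under eq_Rintegral do rewrite fejer_meanE.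
rewrite Rintegral_sum /=; last first.
  move=> j; apply: (iZ _ _ (iD _ _ _)).
transitivity (\sum_(j < N.*2.+1) fejer_weight N j *
    (cos_coef (fejer_freq N j) * (fejer_freq N j == 0)%:R)).
  apply: eq_bigr => j _; rewrite RintegralZl//; last first.
    exact: iD.
  congr (_ * _); rewrite RintegralD//; last 2 first.
  - exact: (iZ _ _ (ic _)).
  - exact: (iZ _ _ (is_ _)).
  rewrite !RintegralZl//.
  by rewrite torus_integral_cosz torus_integral_sinz mulr0 addr0.
(* The zero frequency sits at the index [N], the middle of the range. *)
have NN : (N < N.*2.+1)%N by rewrite ltnS -addnn leq_addr.
rewrite (bigD1 (Ordinal NN))//= big1 ?addr0; last first.
  move=> j jN; rewrite /fejer_freq subr_eq0 eqz_nat.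
  by move: jN; rewrite -val_eqE /= => /negPf ->; rewrite !mulr0.
rewrite /fejer_weight /fejer_freq subrr normr0 mul0r subr0 mul1r mulr1.
by apply: eq_Rintegral => y _; rewrite mul0r cos0 mul1r.
Qed.

End fejer_mean.
End torus.

(** * The norm and entropy inequalities with their equality cases *)

Theorem proposition2p4 (R : realType) (N : nat) (g : R -> R) (s : R)
    (g_periodic : periodic g (pi *+ 2))
    (g_L1 : g \in Lfun torus_measure 1%E)
    (g_ge0 : {ae torus_measure, forall x, 0 <= g x})
    (sE : s = \int[torus_measure]_x g x)
    (s_gt0 : 0 < s) :
  let sigma := fejer_mean N g in
  let entropy :=
    ((s^-1)%:E * \int[torus_measure]_x (sigma x * ln (sigma x / s))%:E)%E in
  [/\ forall p : R, 1 <= p ->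
        (s%:E <= 'N[torus_measure]_(p%:E)[EFin \o sigma])%E,
      {ae torus_measure, forall x, 0 < sigma x} -> (0 <= entropy)%E,
      forall p : R, 1 < p ->
        ('N[torus_measure]_(p%:E)[EFin \o sigma] = s%:E)%E <->
        {ae torus_measure, forall x, sigma x = s} &
      {ae torus_measure, forall x, 0 < sigma x} ->
        (entropy = 0%E <-> {ae torus_measure, forall x, sigma x = s})].
Proof.
move=> sigma entropy.
have g_int := (Lfun1_integrable _ _).1 g_L1.
have isig : torus_measure.-integrable setT (EFin \o sigma).
  exact: fejer_mean_integrable.
have sigs : \int[torus_measure]_x sigma x = s by rewrite sE Rintegral_fejer_mean.
have [M sigM] := fejer_mean_bounded N g_int.
have msig : measurable_fun [set: R] sigma by exact: measurable_fejer_mean.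
(* As [sigma] takes values in the interval from [- M] to [M], a bound on [phi] there suffices for
   integrability. *)
have int_phi (phi : R -> R) (B : R) : measurable_fun [set: R] phi ->
    (forall t, `|t| <= M -> `|phi t| <= B) ->
    torus_measure.-integrable setT (EFin \o (phi \o sigma)).
  move=> mphi phiB.
  apply: (@probability_bounded_integrable _ (measurableTypeR R) R torus_measure _ B).
    exact: measurableT_comp.
  by move=> x; apply: phiB; exact: sigM.
have ae_phi (phi : R -> R) : measurable_fun [set: R] phi ->
    {ae torus_measure, forall x, sigma x = s} ->
    (\int[torus_measure]_x (phi (sigma x))%:E)%E = (phi s)%:E.
  exact: (@ae_cst_integral _ (measurableTypeR R) R torus_measure).
have mpow (p : R) : measurable_fun [set: R] (fun t : R => `|t| `^ p).
  by apply: (@measurableT_comp _ _ _ _ _ _ (@powR R ^~ p)) => //; exact: normr_measurable.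
have ipow p : 0 <= p ->
    torus_measure.-integrable setT (EFin \o (fun x => `|sigma x| `^ p)).
  move=> p0; apply: (@int_phi _ (M `^ p) (mpow p)) => t tM.
  rewrite ger0_norm ?powR_ge0// ge0_ler_powR// nnegrE//.
  exact: le_trans tM.
have Lpow p : p != 0 -> ('N[torus_measure]_(p%:E)[EFin \o sigma] `^ p =
    \int[torus_measure]_x (`|sigma x| `^ p)%:E)%E.
  by move=> p0; rewrite poweR_Lnorm.
have Leq p : 0 < p -> ('N[torus_measure]_(p%:E)[EFin \o sigma] =
    (\int[torus_measure]_x (`|sigma x| `^ p)%:E) `^ p^-1)%E.
  move=> p0; rewrite -Lpow ?gt_eqF// -poweRrM mulfV ?gt_eqF// poweRe1//.
  exact: Lnorm_ge0.
have sK p : 0 < p -> (s `^ p) `^ p^-1 = s.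
  by move=> p0; rewrite -powRrM mulfV ?gt_eqF// powRr1// ltW.
have ment : measurable_fun [set: R] (fun t : R => t * ln (t / s)).
  apply: measurable_funM => //; apply: measurableT_comp => //.
  exact: measurable_funM.
have ient : torus_measure.-integrable setT
    (EFin \o (fun x => sigma x * ln (sigma x / s))).
  by apply: int_phi ment _ => t; exact: xlnx_bound.
(* At [t = s] the function [t * ln (t / s)] has value 0 and slope 1. *)
have ent_tangent x : 0 + 1 * (sigma x - s) <= sigma x * ln (sigma x / s).
  by rewrite add0r mul1r; exact: xlnx_tangent.
have [ent_ge0 ent_eq0] := tangent_integral_ge isig ient sigs ent_tangent.
have si_gt0 : (0 < (s^-1)%:E)%E by rewrite lte_fin invr_gt0.
have pow_ge p (p1 : 1 <= p) := tangent_integral_ge isig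
  (ipow p (le_trans ler01 p1)) sigs (fun x => powR_tangent (sigma x) p1 s_gt0).
split.
- move=> p p1; have p0 : 0 < p by exact: lt_le_trans p1.
  have [h _] := pow_ge p p1; rewrite Leq//.
  (* Finiteness of the integral lets the [p]-th root be compared in the reals, where it is
     monotone. *)
  have /fineK E := integrable_fin_num measurableT (ipow p (ltW p0)).
  rewrite -[X in (X `^ _)%E]E poweR_EFin lee_fin -[leLHS](sK p)//.
  have h' : s `^ p <= fine (\int[torus_measure]_x (`|sigma x| `^ p)%:E).
    by rewrite -lee_fin [leRHS]E.
  rewrite ge0_ler_powR ?invr_ge0 ?(ltW p0)// nnegrE ?powR_ge0//.
  exact: le_trans (powR_ge0 _ _) h'.
- by move=> _; rewrite /entropy mule_ge0// ltW.
- move=> p p1; have p0 : 0 < p by exact: lt_trans p1.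
  split=> [Ns|aes].
    have [_ h] := pow_ge p (ltW p1); apply: h.
      by move=> x; exact: powR_tangent_eq.
    (* Raising the norm equality to the power [p] gives the integral equality that [h] asks for. *)
    by rewrite -Lpow ?gt_eqF// Ns poweR_EFin.
  by rewrite Leq// (@ae_phi (fun t => `|t| `^ p))// gtr0_norm// poweR_EFin sK.
- move=> _; split=> [/eqP|aes].
    rewrite /entropy mule_eq0 gt_eqF//= => /eqP; apply: ent_eq0.
    by move=> x; rewrite add0r mul1r; exact: xlnx_tangent_eq.
  rewrite /entropy (@ae_phi (fun t => t * ln (t / s)))//.
  by rewrite divff ?gt_eqF// ln1 mulr0 mule0.
Qed.
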